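(* Let $(R,\mathfrak{m},k)$ be a Noetherian local ring of characteristic $p>0$ possessing a $q_0$-weak test element $c$. Let $I$, $J$ be ideals of $R$ such that $J\subseteq I\subseteq(J+\mathfrak{m}I)^*$. Then $I\subseteq J^*$.
   Context: For a power $q$ of $p$, $I^{[q]}$ denotes the ideal generated by the $q$-th powers of the elements of $I$. The tight closure $I^*$ of an ideal $I$ is the set of $x\in R$ for which there exist a power $q_1$ of $p$ and an element $d$ not in any minimal prime of $R$ (both possibly depending on $x$ and $I$) such that $dx^q\in I^{[q]}$ for all powers $q\ge q_1$ of $p$. For a power $q_0$ of $p$, an element $c\in R$ is a $q_0$-weak test element if it is not in any minimal prime of $R$ and for all $x\in R$ and all ideals $I$ of $R$, $x\in I^*$ if and only if $cx^q\in I^{[q]}$ for all powers $q\ge q_0$ of $p$. *)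

(* Defs.v *)
From mathcomp Require Import all_boot all_algebra.
From mathcomp Require Import classical_sets.

Set Implicit Arguments.
Unset Strict Implicit.
Unset Printing Implicit Defensive.

Import GRing.Theory.
Local Open Scope classical_set_scope.
Local Open Scope ring_scope.

Section TightClosure.
Variable R : comNzRingType.
Implicit Types (I J K M P Q G : set R) (x c d : R) (p q : nat).

(* Unlike [idealr] of ring_quotient, which is boolean and excludes the unit
   ideal, [is_ideal] is Prop-valued and allows I = R. *)
Definition is_ideal I : Prop :=
  [/\ I 0, forall x y, I x -> I y -> I (x + y) & forall a x, I x -> I (a * x)].

Definition ideal_gen G : set R := smallest is_ideal G.

Definition ideal_add I J : set R := [set x + y | x in I & y in J].

Definition ideal_mul I J : set R := ideal_gen [set x * y | x in I & y in J].

Definition is_prime_ideal P : Prop :=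
  [/\ is_ideal P, ~ P 1 & forall x y, P (x * y) -> P x \/ P y].

Definition is_minimal_prime P : Prop :=
  is_prime_ideal P /\ forall Q, is_prime_ideal Q -> Q `<=` P -> Q = P.

Definition is_maximal_ideal M : Prop :=
  [/\ is_ideal M, M <> setT &
      forall K, is_ideal K -> M `<=` K -> K = M \/ K = setT].

Definition is_local_with M : Prop :=
  is_maximal_ideal M /\ forall K, is_maximal_ideal K -> K = M.

Definition is_noetherian : Prop :=
  forall I, is_ideal I -> exists s : seq R, I = ideal_gen [set` s].

Definition avoids_minimal_primes d : Prop :=
  forall P, is_minimal_prime P -> ~ P d.

(* q = 1 is allowed. *)
Definition is_power_of p q : Prop := exists e : nat, q = (p ^ e)%N.

(* The ideal written I^[q]. *)
Definition bracket_power I q : set R := ideal_gen [set x ^+ q | x in I].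

Definition tight_closure p I : set R :=
  [set x | exists q1 d, [/\ is_power_of p q1, avoids_minimal_primes d &
     forall q, is_power_of p q -> (q1 <= q)%N ->
       bracket_power I q (d * x ^+ q)]].

Definition weak_test_element p (q0 : nat) c : Prop :=
  avoids_minimal_primes c /\
  forall x I, is_ideal I ->
    (tight_closure p I x <->
     forall q, is_power_of p q -> (q0 <= q)%N ->
       bracket_power I q (c * x ^+ q)).

End TightClosure.

Arguments is_noetherian R : clear implicits.

(* Main.v *)
(** Multiplying repeatedly by [c], the hypothesis on [I] gives
    [c^n x^q \in (J + m^n I)^[q]] for all [x \in I], [q >= q0] and [n], so that
    [x] lies in the tight closure of [J + m^n I]. As the test element does not
    depend on [n], [c x^q \in (J + m^n I)^[q] \subseteq J^[q] + m^n] for all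
    [n], and Krull's intersection theorem yields [c x^q \in J^[q]]. *)
Require Import Defs.
From mathcomp Require Import all_boot all_algebra.
From mathcomp Require Import classical_sets boolp.

Import GRing.Theory.
Local Open Scope classical_set_scope.
Local Open Scope ring_scope.

Section Ideals.
Variable R : comNzRingType.
Implicit Types (A B G I J K L m : set R) (a x y : R) (n k p q : nat).

(** * Sums, products and colons of ideals *)

Lemma ideal_gen_ideal G : is_ideal (ideal_gen G).
Proof.
split=> [A [[]]//|x y Gx Gy A GA|a x Gx A GA].
- by case: (GA) => -[_ addA _] _; apply: addA; [apply: Gx|apply: Gy].
- by case: (GA) => -[_ _ mulA] _; apply: mulA; apply: Gx.
Qed.

Lemma idealT : is_ideal [set: R].
Proof. by []. Qed.

Lemma idealN I x : is_ideal I -> I x -> I (- x).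
Proof. by move=> [_ _ mulI] Ix; rewrite -mulN1r; apply: mulI. Qed.

Lemma ideal_add_ideal I J :
  is_ideal I -> is_ideal J -> is_ideal (ideal_add I J).
Proof.
move=> [I0 addI mulI] [J0 addJ mulJ]; split.
- by exists 0 => //; exists 0 => //; rewrite addr0.
- move=> _ _ [x Ix [y Jy <-]] [x' Ix' [y' Jy' <-]].
  exists (x + x'); first exact: addI.
  by exists (y + y'); [exact: addJ|rewrite addrACA].
- move=> a _ [x Ix [y Jy <-]]; exists (a * x); first exact: mulI.
  by exists (a * y); [exact: mulJ|rewrite mulrDr].
Qed.

Lemma ideal_add_subl I J : is_ideal J -> I `<=` ideal_add I J.
Proof. by move=> [J0 _ _] x Ix; exists x => //; exists 0 => //; rewrite addr0. Qed.

Lemma ideal_add_subr I J : is_ideal I -> J `<=` ideal_add I J.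
Proof. by move=> [I0 _ _] x Jx; exists 0 => //; exists x => //; rewrite add0r. Qed.

Lemma ideal_mul_mem I J x y : I x -> J y -> ideal_mul I J (x * y).
Proof. by move=> Ix Jy; apply: sub_gen_smallest; exists x => //; exists y. Qed.

Lemma ideal_mulS m I J : I `<=` J -> ideal_mul m I `<=` ideal_mul m J.
Proof.
move=> IJ; apply: smallest_sub; first exact: ideal_gen_ideal.
by move=> _ [a ma [x Ix <-]]; apply: ideal_mul_mem => //; apply: IJ.
Qed.

Lemma colon_ideal I a : is_ideal I -> is_ideal [set x | I (a * x)].
Proof.
move=> [I0 addI mulI]; split=> /= [|x y Ix Iy|b x Ix].
- by rewrite mulr0.
- by rewrite mulrDr; apply: addI.
- by rewrite mulrCA; apply: mulI.
Qed.

Lemma scale_ideal I a : is_ideal I -> is_ideal [set a * x | x in I].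
Proof.
move=> [I0 addI mulI]; split=> [|_ _ [x Ix <-] [y Iy <-]|b _ [x Ix <-]].
- by exists 0 => //; rewrite mulr0.
- by exists (x + y); [exact: addI|rewrite mulrDr].
- by exists (b * x); [exact: mulI|rewrite mulrCA].
Qed.

(** The iterate stands for $m^n I$, and for $m^n$ when [I] is [setT]. At [n = 0] it is [I] itself
    rather than a generated ideal. *)
Lemma ideal_iter m n I :
  is_ideal I -> is_ideal (iter n (ideal_mul m) I).
Proof. by case: n => // n _; apply: ideal_gen_ideal. Qed.

Lemma iter_ideal_mulS m n I J :
  I `<=` J -> iter n (ideal_mul m) I `<=` iter n (ideal_mul m) J.
Proof. by move=> IJ; elim: n => //= n; apply: ideal_mulS. Qed.

(** * Noetherian rings and Krull's intersection theorem *)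

(* Zorn's lemma asks for a bound of the empty chain as well, hence the
   additional member [set0]. *)
Lemma noetherian_maximal (Q : set R -> Prop) I0 :
  is_noetherian R -> is_ideal I0 -> Q I0 ->
  exists M, [/\ is_ideal M, Q M &
    forall B, is_ideal B -> Q B -> M `<=` B -> B = M].
Proof.
move=> noeth I0_ideal QI0.
pose P A := A = set0 \/ is_ideal A /\ Q A.
have [F FP Ftot|M [[M0|[M_ideal QM]] maxM]] := @Zorn_bigcup R P.
- have [Fne|Fe] := pselect (exists X, F X /\ is_ideal X); last first.
    left; rewrite -subset0 => x [X FX Xx].
    have [X0|[X_ideal _]] := FP X FX; first by rewrite X0 in Xx.
    by case: Fe; exists X.
  right; have [X0 [FX0 X0_ideal]] := Fne.
  have U_ideal : is_ideal (\bigcup_(X in F) X).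
    split.
    + by exists X0 => //; case: X0_ideal.
    + move=> x y [X FX Xx] [Y FY Yy].
      have memI Z z : F Z -> Z z -> is_ideal Z.
        by move=> FZ Zz; case: (FP Z FZ) => [Z0|[]//]; rewrite Z0 in Zz.
      have [XY|YX] := Ftot _ _ FX FY.
        exists Y => //; have [_ addY _] := memI _ _ FY Yy.
        by apply: addY => //; apply: XY.
      exists X => //; have [_ addX _] := memI _ _ FX Xx.
      by apply: addX => //; apply: YX.
    + move=> a x [X FX Xx]; exists X => //.
      case: (FP X FX) => [X0'|[[_ _ mulX] _]]; first by rewrite X0' in Xx.
      exact: mulX.
  (* [Q] need not pass to unions of chains. But the union is finitely generated, and one member of
     the chain contains all the generators, so the union equals that member. *)
  have [s Us] := noeth _ U_ideal.
  have sU : forall x, x \in s -> (\bigcup_(X in F) X) x.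
    by move=> x xs; rewrite Us; apply: sub_gen_smallest.
  have [X FX [X_ideal sX]] : exists2 X, F X & is_ideal X /\ [set` s] `<=` X.
    elim: s sU {Us} => [|x s IHs] sU; first by exists X0.
    have [|X FX [X_ideal sX]] := IHs.
      by move=> y ys; apply: sU; rewrite inE ys orbT.
    have [Y FY Yx] := sU x (mem_head _ _).
    have [XY|YX] := Ftot _ _ FX FY.
      exists Y => //; split=> [|y /=].
        by case: (FP Y FY) => [Y0|[]//]; rewrite Y0 in Yx.
      by rewrite inE => /predU1P[->//|ys]; apply: XY; apply: sX.
    exists X => //; split=> // y /=.
    by rewrite inE => /predU1P[->|ys]; [apply: YX|apply: sX].
  have <- : X = \bigcup_(X in F) X.
    apply/seteqP; split=> [x Xx|]; first by exists X.
    by rewrite Us; apply: smallest_sub.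
  split=> //; have [XE|[]//] := FP X FX.
  by case: X_ideal; rewrite XE.
(* The maximal member is not [set0], which lies strictly below [I0]. *)
- case: (maxM I0); last by right.
  rewrite M0 properEneq; split=> //; apply/eqP => E.
  by case: I0_ideal; rewrite -E.
- exists M; split=> // B B_ideal QB MB; apply: contrapT => BM.
  apply: (maxM B); last by right.
  by rewrite properEneq; split=> //; apply/eqP => E; apply: BM.
Qed.

(* Noetherian induction: for [a \in m] outside [L], both [L + aR] and [(L : a)]
   are larger than [L], and [m^n1 \subseteq L + aR], [m^n2 \subseteq (L : a)]
   give [m^(n2 + n1) \subseteq L + a m^n2 \subseteq L]. *)
Lemma power_subset m I :
  is_noetherian R -> is_ideal I ->
  (forall a, m a -> exists t, I (a ^+ t)) ->
  exists n, iter n (ideal_mul m) setT `<=` I.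
Proof.
move=> noeth I_ideal I_nil; apply: contrapT => noI.
pose bad L := (forall a, m a -> exists t, L (a ^+ t)) /\
  ~ exists n, iter n (ideal_mul m) setT `<=` L.
have [L [L_ideal [L_nil noL] maxL]] := @noetherian_maximal bad I noeth I_ideal
  (conj I_nil noI).
have good B : is_ideal B -> L `<=` B -> B <> L ->
    exists n, iter n (ideal_mul m) setT `<=` B.
  move=> B_ideal LB BL; apply: contrapT => noB; apply: BL.
  apply: maxL => //; split=> // a /L_nil[t Lt]; exists t; exact: LB.
have [L0 addL mulL] := L_ideal.
have [mL|/existsNP[a /not_implyP[ma La]]] := pselect (m `<=` L).
  apply: noL; exists 1%N => /=; apply: smallest_sub => //.
  by move=> _ [x mx [y _ <-]]; rewrite mulrC; apply/mulL/mL.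
have aR_ideal := scale_ideal _ a idealT.
have [|||n1 n1P] := good (ideal_add L [set a * x | x in setT]).
- exact: ideal_add_ideal.
- exact: ideal_add_subl.
- move=> E; apply: La; rewrite -E; apply: ideal_add_subr => //.
  by exists 1 => //; rewrite mulr1.
have [|||n2 n2P] := good [set x | L (a * x)].
- exact: colon_ideal.
- by move=> x Lx /=; apply: mulL.
(* If $(L : a) = L$, the factors of $a^t \in L$ can be cancelled one by one until $1 \in L$,
   contradicting $a \notin L$. *)
- move=> E; have [t Lt] := L_nil a ma; elim: t Lt => [|t IHt].
    by rewrite expr0 => L1; apply: La; rewrite -[a]mulr1; apply: mulL.
  by rewrite exprS => Lt; apply: IHt; rewrite -E.
apply: noL; exists (n2 + n1)%N; rewrite iterD.
have sub k : iter k (ideal_mul m) (ideal_add L [set a * x | x in setT]) `<=`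
    ideal_add L [set a * x | x in iter k (ideal_mul m) setT].
  elim: k => //= k IHk; apply: smallest_sub.
    by apply/ideal_add_ideal/scale_ideal/ideal_gen_ideal.
  move=> _ [b mb [_ /IHk[x Lx [_ [y ky <-] <-]] <-]].
  exists (b * x); first exact: mulL.
  exists (a * (b * y)); last by rewrite mulrDr (mulrCA a).
  by exists (b * y) => //; apply: ideal_mul_mem.
apply: (subset_trans (iter_ideal_mulS _ _ _ _ n1P)).
apply: (subset_trans (sub n2)) => _ [x Lx [_ [y n2y <-] <-]].
by apply: addL => //; apply: n2P.
Qed.

(** If [1 - a] were not a unit, an ideal maximal among the proper ideals containing it would be a
    maximal ideal, hence [m]; then $1 = (1 - a) + a$ would lie in [m]. *)
Lemma local_unit m a :
  is_noetherian R -> is_local_with m -> m a -> exists b, b * (1 - a) = 1.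
Proof.
move=> noeth [[m_ideal m_proper _] m_unique] ma; apply: contrapT => no_inv.
pose Q A := A (1 - a) /\ A <> setT.
pose A0 := [set (1 - a) * x | x in [set: R]].
have A0_ideal : is_ideal A0 := scale_ideal _ _ idealT.
have QA0 : Q A0.
  split; first by exists 1 => //; rewrite mulr1.
  move=> A0T; have [b _ ab] : A0 1 by rewrite A0T.
  by apply: no_inv; exists b; rewrite mulrC.
have [M [M_ideal [Ma MT] maxM]] := noetherian_maximal Q A0 noeth A0_ideal QA0.
have mM : M = m.
  apply: m_unique; split=> // K K_ideal MK.
  have [|KT] := pselect (K = setT); first by right.
  by left; apply: maxM => //; split=> //; apply: MK.
apply: m_proper; apply/seteqP; split=> // x _.
have [_ addm mulm] := m_ideal.
rewrite -[x]mulr1; apply: mulm; rewrite -(subrK a 1).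
by apply: addm => //; rewrite -mM.
Qed.

(* If [y] is not in [K] then, by Nakayama, it is not in [K + m y] either. An
   ideal [L] containing [K + m y] and maximal for not containing [y] contains
   some power of every [a \in m]: if the colon ideals of [L] by the powers of
   [a] stabilize at [t], then [y] is not in [L + a^t R]. Hence [L] contains a
   power of [m], and [y \in K + m^n \subseteq L]. *)
Lemma krull_intersection m K y :
  is_noetherian R -> is_local_with m -> is_ideal K ->
  (forall n, ideal_add K (iter n (ideal_mul m) setT) y) -> K y.
Proof.
move=> noeth m_local K_ideal yP; apply: contrapT => Ky.
have m_ideal : is_ideal m by case: m_local => -[].
have [_ addK mulK] := K_ideal.
pose Q L := K `<=` L /\ (forall a, m a -> L (a * y)) /\ ~ L y.
pose L0 := ideal_add K [set y * a | a in m].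
have ym_ideal : is_ideal [set y * a | a in m] by apply: scale_ideal.
have L0_ideal : is_ideal L0 by apply: ideal_add_ideal.
have QL0 : Q L0.
  split; first exact: ideal_add_subl.
  split=> [a ma|[k Kk [_ [a ma <-] yE]]].
    by apply: ideal_add_subr => //; exists a => //; rewrite mulrC.
  (* From $y = k + ya$ one gets $(1 - a) y = k \in K$, and $1 - a$ is a unit. *)
  apply: Ky; have [b b1] := local_unit m a noeth m_local ma.
  rewrite -[y]mul1r -b1 -mulrA; apply: mulK.
  by rewrite mulrBl mul1r -{1}yE (mulrC a) addrK.
have [L [L_ideal [KL [mL Ly]] maxL]] :=
  noetherian_maximal Q L0 noeth L0_ideal QL0.
have [L0' addL mulL] := L_ideal.
have [a ma|n nL] := power_subset m L noeth L_ideal.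
  pose col B := exists t, B = [set x | L (a ^+ t * x)].
  have [_ [_ [t ->] maxt]] := noetherian_maximal col [set x | L (a ^+ 0 * x)]
    noeth (colon_ideal _ _ L_ideal) (ex_intro _ 0%N erefl).
  have stab x : L (a ^+ t.+1 * x) -> L (a ^+ t * x).
    have E := maxt [set x | L (a ^+ t.+1 * x)] (colon_ideal _ _ L_ideal)
      (ex_intro _ t.+1 erefl).
    move=> Lx; have : [set x | L (a ^+ t.+1 * x)] x by [].
    by rewrite E // => z /= Lz; rewrite exprS -mulrA; apply: mulL.
  pose B := ideal_add L [set a ^+ t * x | x in setT].
  have at_ideal : is_ideal [set a ^+ t * x | x in setT].
    by apply: scale_ideal; apply: idealT.
  have LB : L `<=` B by apply: ideal_add_subl.
  exists t; suff <- : B = L.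
    by apply: ideal_add_subr => //; exists 1 => //; rewrite mulr1.
  apply: maxL => //; first exact: ideal_add_ideal.
  split; first exact: subset_trans LB.
  split=> [b mb|[l Ll [_ [r _ <-] yE]]]; first by apply: LB; apply: mL.
  (* If $y = l + a^t r$, then $a^{t+1} r = ay - al$ lies in [L] because $my \subseteq L$. Stability
     gives $a^t r \in L$, so $y \in L$. *)
  apply: (Ly); rewrite -yE; apply: (addL) => //; apply: stab.
  rewrite exprS -mulrA -[X in L X](addKr (a * l)) -mulrDr yE.
  by apply: addL; [apply: idealN => //; apply: mulL|apply: mL].
have [k Kk [u mu yE]] := yP n.
by apply: Ly; rewrite -yE; apply: addL; [apply: KL|apply: nL].
Qed.

(** * Bracket powers in characteristic $p$ *)

Lemma bracket_power_ideal I q : is_ideal (bracket_power I q).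
Proof. exact: ideal_gen_ideal. Qed.

Lemma bracket_power_mem I q x : I x -> bracket_power I q (x ^+ q).
Proof. by move=> Ix; apply: sub_gen_smallest; exists x. Qed.

Lemma bracket_powerS I J q :
  I `<=` J -> bracket_power I q `<=` bracket_power J q.
Proof.
move=> IJ; apply: smallest_sub; first exact: bracket_power_ideal.
by move=> _ [x Ix <-]; apply: bracket_power_mem; apply: IJ.
Qed.

Lemma power_of_pchar_gt0 p q :
  p \in [pchar R] -> is_power_of p q -> (0 < q)%N.
Proof. by move=> /pcharf_prime/prime_gt0 p0 [e ->]; rewrite expn_gt0 p0. Qed.

Lemma exprD_pchar p q x y :
  p \in [pchar R] -> is_power_of p q -> (x + y) ^+ q = x ^+ q + y ^+ q.
Proof.
move=> pR [e ->]; apply: exprDn_pchar.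
by rewrite pnatX pnatE ?pR //; apply: pcharf_prime pR.
Qed.

(** This rests on the additivity of $x \mapsto x^q$. It allows $c x^q \in B^{[q]}$ to be checked
    only on generators of the ideal over which $x$ ranges. *)
Lemma bracket_colon_ideal p q c B :
  p \in [pchar R] -> is_power_of p q ->
  is_ideal [set x | bracket_power B q (c * x ^+ q)].
Proof.
move=> pR qP; have [B0 addB mulB] := bracket_power_ideal B q.
split=> /= [|x y Bx By|a x Bx].
- by rewrite expr0n gtn_eqF ?mulr0 ?(power_of_pchar_gt0 p).
- by rewrite (exprD_pchar p) // mulrDr; apply: addB.
- by rewrite exprMn mulrCA; apply: mulB.
Qed.

(** For a generator $av$ of $m^{n+1} I$, write $c (av)^q = a^q (c v^q)$. Multiplication by $a^q$
    sends a generator $(j + w)^q$ to $(aj + aw)^q$, which keeps $aj$ in [J] and gains one factor of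
    [m] in $aw$. *)
Lemma bracket_iter_step m p q c n I J :
  p \in [pchar R] -> is_power_of p q -> is_ideal J ->
  (forall x, I x -> bracket_power (ideal_add J (ideal_mul m I)) q (c * x ^+ q)) ->
  forall u, iter n (ideal_mul m) I u ->
    bracket_power (ideal_add J (iter n.+1 (ideal_mul m) I)) q (c * u ^+ q).
Proof.
move=> pR qP J_ideal IP; elim: n => // n IHn; rewrite iterS.
apply: smallest_sub; first exact: (bracket_colon_ideal p).
move=> _ [a ma [v /IHn vP <-]] /=; rewrite exprMn mulrCA.
set B := ideal_add _ (ideal_mul m _).
have aP : is_ideal [set w | bracket_power B q (a ^+ q * w)].
  by apply: colon_ideal; apply: bracket_power_ideal.
apply: (smallest_sub aP _ vP) => _ [_ [j Jj [w wP <-]] <-] /=.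
rewrite -exprMn; apply: bracket_power_mem; rewrite mulrDr.
have [_ _ mulJ] := J_ideal.
exists (a * j); first exact: mulJ.
by exists (a * w) => //; apply: ideal_mul_mem.
Qed.

(** Each further factor [c] is applied to the generators $(j + u)^q = j^q + u^q$ of $(J + m^n
    I)^{[q]}$: the term $c j^q$ stays in $J^{[q]}$, and [bracket_iter_step] handles $c u^q$. *)
Lemma bracket_iter m p q c n I J :
  p \in [pchar R] -> is_power_of p q -> is_ideal I -> is_ideal J ->
  (forall x, I x -> bracket_power (ideal_add J (ideal_mul m I)) q (c * x ^+ q)) ->
  forall x, I x ->
    bracket_power (ideal_add J (iter n (ideal_mul m) I)) q (c ^+ n * x ^+ q).
Proof.
move=> pR qP I_ideal J_ideal IP x Ix; elim: n => [|n IHn].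
  by rewrite expr0 mul1r; apply: bracket_power_mem; apply: ideal_add_subr.
have cP : is_ideal [set w | bracket_power
    (ideal_add J (iter n.+1 (ideal_mul m) I)) q (c * w)].
  by apply: colon_ideal; apply: bracket_power_ideal.
rewrite exprS -mulrA; apply: (smallest_sub cP _ IHn).
move=> _ [_ [j Jj [u uP <-]] <-] /=; rewrite (exprD_pchar p) // mulrDr.
have [_ addB mulB] := bracket_power_ideal
  (ideal_add J (iter n.+1 (ideal_mul m) I)) q.
apply: addB; last exact: (bracket_iter_step _ p).
apply: mulB; apply: bracket_power_mem; apply: ideal_add_subl => //.
exact: ideal_iter.
Qed.

Lemma bracket_power_add p q A B :
  p \in [pchar R] -> is_power_of p q -> is_ideal B ->
  bracket_power (ideal_add A B) q `<=` ideal_add (bracket_power A q) B.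
Proof.
move=> pR qP B_ideal; apply: smallest_sub.
  by apply: ideal_add_ideal => //; apply: bracket_power_ideal.
move=> _ [_ [a Aa [b Bb <-]] <-]; rewrite (exprD_pchar p) //.
exists (a ^+ q); first exact: bracket_power_mem.
exists (b ^+ q) => //; have := power_of_pchar_gt0 p q pR qP.
by case: (q) => // r _; rewrite exprSr; case: B_ideal => _ _; apply.
Qed.

Lemma avoids_minimal_primesX (c : R) n :
  avoids_minimal_primes c -> avoids_minimal_primes (c ^+ n).
Proof.
move=> cP P Pmin; have [[_ P1 mulP] _] := Pmin.
elim: n => [|n IHn]; first by rewrite expr0.
by rewrite exprS => /mulP[/cP|]; auto.
Qed.

End Ideals.

Theorem proposition2p1 (R : comNzRingType) (m : set R) (p q0 : nat) (c : R)
    (I J : set R)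
    (R_noetherian : is_noetherian R) (R_local : is_local_with m)
    (R_char : p \in [pchar R])
    (q0_power : is_power_of p q0) (c_test : weak_test_element p q0 c)
    (I_ideal : is_ideal I) (J_ideal : is_ideal J)
    (JI : J `<=` I)
    (I_tight : I `<=` tight_closure p (ideal_add J (ideal_mul m I))) :
  I `<=` tight_closure p J.
Proof.
have [c_avoids c_testP] := c_test.
have JnI_ideal n : is_ideal (ideal_add J (iter n (ideal_mul m) I)).
  by apply: ideal_add_ideal => //; apply: ideal_iter.
(* The test element replaces the multiplier and the bound of tight closure, which vary with [x], by
   the fixed [c] and [q0]. *)
have step q x : is_power_of p q -> (q0 <= q)%N -> I x ->
    bracket_power (ideal_add J (ideal_mul m I)) q (c * x ^+ q).
  by move=> qP q0q /I_tight /(c_testP x _ (JnI_ideal 1%N)); apply.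
move=> x Ix; apply/c_testP => // q qP q0q.
apply: (krull_intersection _ m) => // [|n]; first exact: bracket_power_ideal.
apply: (bracket_power_add _ p) => //; first exact: (ideal_iter _ _ _ _ (idealT R)).
apply: (bracket_powerS _ (ideal_add J (iter n (ideal_mul m) I))).
  move=> _ [j Jj [u uP <-]]; exists j => //; exists u => //.
  exact: (iter_ideal_mulS _ _ _ I).
apply: (c_testP x _ (JnI_ideal n)).1 => //.
(* The multiplier may depend on the ideal, hence on [n], so the power of [c] given by [bracket_iter]
   is admissible. *)
exists q0, (c ^+ n); split=> // [|r rP q0r].
  exact: avoids_minimal_primesX.
by apply: (bracket_iter _ m p) => // y; apply: step.
Qed.
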